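(* Let $\hat{\mathbb{P}}_1,\dots,\hat{\mathbb{P}}_N$ be empirical (finitely supported) probability distributions on $\Xi$, let $\rho>0$, $\beta>0$, let $\Lambda=\{\lambda\in\mathbb{R}^N:\lambda_i\ge0,\ \sum_{i=1}^N\lambda_i=1\}$, and $\hat{\mathbb{P}}_\lambda=\sum_{i=1}^N\lambda_i\hat{\mathbb{P}}_i$. Let $L:\Theta\times\Xi\to\mathbb{R}$ be a loss function and $c:\Xi\times\Xi\to[0,\infty)$ a transportation cost. Then the problem $$\min_{\theta\in\Theta}\max_{\lambda\in\Lambda}\sup_{\mathbb{P}\in\mathcal{P}(\Xi)}\Big\{\mathbb{E}_{\xi\sim\mathbb{P}}[L(\theta,\xi)]-\rho\,\mathrm{UW}(\mathbb{P}\,\|\,\hat{\mathbb{P}}_\lambda)\Big\}$$ is equivalent to the problem $$\min_{\theta\in\Theta}\max_{\lambda\in\Lambda}\sum_{i=1}^N\lambda_i\,\mathbb{E}_{\zeta\sim\hat{\mathbb{P}}_i}\Big[e^{\sup_{\xi\in\Xi}\{L(\theta,\xi)-\rho c(\xi,\zeta)\}/(\rho\beta)}\Big],$$ in the sense that for every $\theta\in\Theta$ the two maximization problems over $\lambda\in\Lambda$ have the same maximizers, and the two minimization problems over $\theta\in\Theta$ have the same minimizers.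
   Context: $\mathcal{P}(\Xi)$ is the set of probability distributions on the measurable space $\Xi$; $L(\theta,\cdot)$ and $c$ are measurable. For $\mathbb{P},\hat{\mathbb{P}}\in\mathcal{P}(\Xi)$ the unbalanced Wasserstein distance is $$\mathrm{UW}(\mathbb{P}\,\|\,\hat{\mathbb{P}})=\inf_{\bar{\mathbb{P}}\in\mathcal{P}(\Xi),\ \gamma\in\Gamma(\mathbb{P},\bar{\mathbb{P}})}\Big\{\mathbb{E}_{(\xi,\zeta)\sim\gamma}[c(\xi,\zeta)]+\beta\,\mathrm{D_{KL}}(\bar{\mathbb{P}}\,\|\,\hat{\mathbb{P}})\Big\},$$ where $\Gamma(\mathbb{P},\bar{\mathbb{P}})$ is the set of joint distributions on $\Xi\times\Xi$ with first marginal $\mathbb{P}$ and second marginal $\bar{\mathbb{P}}$, and $\mathrm{D_{KL}}$ is the Kullback–Leibler divergence ($+\infty$ when $\bar{\mathbb{P}}\not\ll\hat{\mathbb{P}}$). The supremum over $\mathbb{P}$ ranges over $\mathbb{P}$ for which $\mathbb{E}_{\xi\sim\mathbb{P}}[L(\theta,\xi)]$ is well defined, the objective being $-\infty$ when $\mathrm{UW}(\mathbb{P}\|\hat{\mathbb{P}}_\lambda)=+\infty$; conventions $e^{+\infty}=+\infty$, $0\cdot\infty=0$. *)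

(* Defs.v *)
(* MathComp / MathComp-Analysis *)
From HB Require Import structures.
From mathcomp Require Import all_boot all_order all_algebra.
From mathcomp Require Import all_classical all_reals all_analysis.

Set Implicit Arguments.
Unset Strict Implicit.
Unset Printing Implicit Defensive.

Import Order.TTheory GRing.Theory Num.Theory.
Import numFieldNormedType.Exports.

Local Open Scope classical_set_scope.
Local Open Scope charge_scope.
Local Open Scope ring_scope.
Local Open Scope ereal_scope.

Definition argmax (R : realType) (T : Type) (J : T -> \bar R) : set T :=
  [set x | forall y, J y <= J x].

Definition argmin (R : realType) (T : Type) (J : T -> \bar R) : set T :=
  [set x | forall y, J x <= J y].

Definition simplex (R : realType) (N : nat) : set 'rV[R]_N :=
  [set lam | (forall i, 0 <= lam ord0 i)%R /\ (\sum_(i < N) lam ord0 i = 1)%R].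
Arguments simplex : clear implicits.

Section mixture.
Context d (T : measurableType d) (R : realType) (N : nat).
Variables (P : 'I_N -> probability T R) (lam : simplex R N).

Definition mixture (A : set T) : \bar R :=
  \sum_(i < N) (val lam ord0 i)%:E * P i A.

Let lam_ge0 i : (0 <= val lam ord0 i)%R.
Proof. by have [] := set_valP lam. Qed.

Let mixture0 : mixture set0 = 0.
Proof. by rewrite /mixture big1// => i _; rewrite measure0 mule0. Qed.

Let mixture_ge0 A : 0 <= mixture A.
Proof. by apply: sume_ge0 => i _; rewrite mule_ge0// lee_fin. Qed.

Let component (k : nat) : {measure set T -> \bar R} :=
  if insub k is Some i then mscale (NngNum (lam_ge0 i)) (P i) else mzero.

Let mixtureE : mixture = msum component N.
Proof.
by apply/funext => A; apply: eq_bigr => i _; rewrite /component valK.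
Qed.

Let mixture_sigma_additive : semi_sigma_additive mixture.
Proof. by rewrite mixtureE; exact: measure_semi_sigma_additive. Qed.

HB.instance Definition _ := isMeasure.Build _ _ _ mixture
  mixture0 mixture_ge0 mixture_sigma_additive.

Let mixture_setT : mixture setT = 1.
Proof.
rewrite /mixture (eq_bigr (fun i => (val lam ord0 i)%:E)); last first.
  by move=> i _; rewrite probability_setT mule1.
by rewrite sumEFin; have [_ ->] := set_valP lam.
Qed.

HB.instance Definition _ :=
  Measure_isProbability.Build _ _ _ mixture mixture_setT.

End mixture.

Section unbalanced_wasserstein.
Context d (Xi : measurableType d) (R : realType).
Implicit Types P Q : probability Xi R.

(* Arbitrary weights on finitely many, not necessarily distinct, atoms;
   singletons of Xi need not be measurable. *)
Definition finitely_supported P : Prop :=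
  exists (n : nat) (w : simplex R n) (z : 'I_n -> Xi),
    forall A, measurable A ->
      P A = mixture (fun j => dirac (z j) : probability Xi R) w A.

Definition KL P Q : \bar R :=
  if `[< P `<< Q >]
  then \int[P]_x lne (('d (charge_of_finite_measure P) '/d Q) x)
  else +oo.

Definition couplings P Q : set (probability (Xi * Xi)%type R) :=
  [set g | (forall A, measurable A -> pushforward g fst A = P A) /\
           (forall A, measurable A -> pushforward g snd A = Q A)].

Definition UW (c : Xi -> Xi -> R) (beta : R) P Q : \bar R :=
  ereal_inf [set \int[pg.2]_z (c z.1 z.2)%:E + beta%:E * KL pg.1 Q |
    pg in [set pg : probability Xi R * probability (Xi * Xi)%type R |
           couplings P pg.1 pg.2]].

(* The expectation of f, with values in [-oo, +oo], is not of the form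
   (+oo) - (+oo). *)
Definition expectation_defined P (f : Xi -> R) : Prop :=
  (\int[P]_x (EFin \o f)^\+ x) +? (- \int[P]_x (EFin \o f)^\- x).

End unbalanced_wasserstein.

Section objectives.
Context d (Xi : measurableType d) (R : realType) (N : nat) (Theta : Type).
Variables (Phat : 'I_N -> probability Xi R) (rho beta : R).
Variables (L : Theta -> Xi -> R) (c : Xi -> Xi -> R).

(* In \bar R, +oo - +oo = -oo: the objective is -oo as soon as UW = +oo. *)
Definition robust_objective (theta : Theta) (lam : simplex R N) : \bar R :=
  ereal_sup [set \int[P]_x (L theta x)%:E
                 - rho%:E * UW c beta P (mixture Phat lam) |
    P in [set P : probability Xi R | expectation_defined P (L theta)]].

(* In \bar R, 0 * +oo = 0, and expeR +oo = +oo. *)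
Definition exponential_objective (theta : Theta) (lam : simplex R N) : \bar R :=
  \sum_(i < N) (val lam ord0 i)%:E *
    \int[Phat i]_zeta
      expeR (ereal_sup (range (fun xi => (L theta xi - rho * c xi zeta)%:E))
             * (rho * beta)^-1%:E).

End objectives.

(* Main.v *)
(* Everything follows from the identity E = exp (V / (rho beta)) between the
   exponential objective E and the robust objective V at each (theta, lambda),
   x |-> exp (x / (rho beta)) being an order embedding of [-oo, +oo].

   Write f(zeta) = sup_xi (L xi - rho c(xi, zeta)), let Q be the mixture and
   q_k > 0 its weights at its atoms z_k.  If P is coupled with Pb << Q, then Pb
   has weights q_k r_k, and the coupling only charges the sections over the
   z_k, so E_P[L] <= rho E[c] + sum_k q_k r_k f(z_k); Gibbs' inequality bounds
   the value of P by rho beta ln E.  Conversely, for any points xi_k,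
   transporting xi_k to z_k with Gibbs weights p_k ~ q_k exp (F_k), where
   F_k = (L xi_k - rho c(xi_k, z_k)) / (rho beta), attains at least
   rho beta ln (sum_k q_k exp (F_k)); take the supremum over each xi_k.

   Neither the singletons of Xi nor f need be measurable.  Both problems
   disappear because a measurable set of X * Y has the same sections over all
   points of some measurable set around a given y. *)
Require Import Defs.
From mathcomp Require Import all_boot all_order all_algebra.
From mathcomp Require Import all_classical all_reals all_analysis.
From mathcomp Require Import measurable_realfun ring lra.
Import Order.TTheory GRing.Theory Num.Theory.
Import numFieldNormedType.Exports.
Local Open Scope classical_set_scope.
Local Open Scope ring_scope.

(* The points z k may coincide, or be inseparable by measurable sets, so the
   weights p are not determined by mu. *)
Definition atomic {d} {T : measurableType d} {R : realType} (mu : set T -> \bar R)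
    {n} (p : 'I_n -> R) (z : 'I_n -> T) : Prop :=
  (forall k, 0 <= p k) /\
  forall A, measurable A -> mu A = (\sum_(k < n) (p k)%:E * \d_(z k) A)%E.

(** * Integrals against finitely supported measures *)

Section atomic_integral.
Local Open Scope ereal_scope.
Context {d : measure_display} {T : measurableType d} {R : realType}.
Context {mu : {measure set T -> \bar R}} {n : nat}.
Context {p : 'I_n -> R} {z : 'I_n -> T}.
Hypothesis muE : atomic mu p z.

Lemma ge0_integral_atomic (f : T -> \bar R) :
  measurable_fun setT f -> (forall x, 0 <= f x) ->
  \int[mu]_x f x = \sum_(k < n) (p k)%:E * f (z k).
Proof.
move=> mf f0; have [p0 muA] := muE.
pose m (k : nat) : {measure set T -> \bar R} :=
  if insub k is Some i then mscale (NngNum (p0 i)) (dirac (z i)) else mzero.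
transitivity (\int[msum m n]_x f x).
  apply: eq_measure_integral => A mA _; rewrite muA//= /msum.
  by apply: eq_bigr => i _; rewrite /m valK.
rewrite ge0_integral_measure_sum//; apply: eq_bigr => i _.
rewrite /m valK ge0_integral_mscale//= integral_dirac//.
by rewrite diracT mul1e.
Qed.

(** Finiteness is asked only at positive weights, since [0 * oo = 0]: [f] may be [lne] of a density
    vanishing at the other atoms. *)
Lemma integral_atomic (f : T -> \bar R) : measurable_fun setT f ->
  (forall k, (0 < p k)%R -> f (z k) \is a fin_num) ->
  \int[mu]_x f x = (\sum_(k < n) p k * fine (f (z k)))%:E.
Proof.
move=> mf ffin; have [p0 _] := muE.
rewrite integralE !ge0_integral_atomic//; last 2 first.
- exact: measurable_funeneg.
- exact: measurable_funepos.
have pE (g : T -> \bar R) : (forall k, (0 < p k)%R -> g (z k) \is a fin_num) ->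
    \sum_(k < n) (p k)%:E * g (z k) = (\sum_(k < n) p k * fine (g (z k)))%:E.
  move=> gfin; rewrite -sumEFin; apply: eq_bigr => k _.
  have := p0 k; rewrite le_eqVlt => /predU1P[<-|pk]; first by rewrite mul0e mul0r.
  by rewrite EFinM fineK// gfin.
rewrite !pE; last 2 first.
- by move=> k /ffin; rewrite unlock /maxe; case: ifP; rewrite ?fin_numN.
- by move=> k /ffin; rewrite unlock /maxe; case: ifP.
rewrite -EFinB -sumrB; congr EFin; apply: eq_bigr => k _.
rewrite -mulrBr.
have := p0 k; rewrite le_eqVlt => /predU1P[<-|pk]; first by rewrite !mul0r.
congr *%R.
have := ffin _ pk; case rr : (f (z k)) => [r| |]// _.
rewrite funeposE funenegE rr -EFinN.
have [r0|r0] := leP 0%R r.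
  by rewrite max_l ?lee_fin// max_r ?lee_fin ?oppr_le0//= subr0.
by rewrite max_r ?lee_fin ?ltW// max_l ?lee_fin ?oppr_ge0 ?ltW//= sub0r opprK.
Qed.

End atomic_integral.

Lemma atomic_sum1 {d} {T : measurableType d} {R : realType}
    {P : probability T R} {n} {p : 'I_n -> R} {z : 'I_n -> T} :
  atomic P p z -> \sum_(k < n) p k = 1.
Proof.
move=> [_ PE]; apply/EFin_inj; rewrite -(@probability_setT _ _ _ P) PE//.
by rewrite -sumEFin; apply: eq_bigr => k _; rewrite diracT mule1.
Qed.

(** * Sections of measurable sets and functions on a product *)

Section sections.
Context {d1 d2 : measure_display}.
Context {X : measurableType d1} {Y : measurableType d2}.

(* The sets A with this property form a sigma-algebra containing the
   rectangles. *)
Lemma section_locally_constant (A : set (X * Y)) (y : Y) : measurable A ->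
  exists W : set Y, [/\ measurable W, W y &
    forall y', W y' -> forall x, A (x, y') = A (x, y)].
Proof.
rewrite measurable_prod_measurableType.
pose G := [set A : set (X * Y) | exists W : set Y, [/\ measurable W, W y &
    forall y', W y' -> forall x, A (x, y') = A (x, y)]].
move=> mA; suff: G A by [].
apply: mA => {A}; split.
  split.
  - by exists setT; split.
  - move=> A [W [mW Wy WA]]; exists W; split => // y' Wy' x.
    by rewrite /setD/= WA.
  - move=> F mF.
    have /choice[W WP] : forall i, exists W : set Y, [/\ measurable W, W y &
      forall y', W y' -> forall x, F i (x, y') = F i (x, y)] by exact: mF.
    exists (\bigcap_i W i); split.
    + by apply: bigcapT_measurable => i; have [] := WP i.
    + by move=> i _; have [] := WP i.
    + move=> y' Wy' x; apply/propext; split => -[i _ Fi]; exists i => //;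
        have [_ _ WF] := WP i; first by rewrite -(WF y')//; exact: Wy'.
      by rewrite WF//; exact: Wy'.
(* For a rectangle, [B] or its complement serves, whichever contains [y]. *)
move=> _ [A mA [B mB] <-].
have [By|By] := pselect (B y).
  exists B; split => // y' By' x /=.
  by apply/propext; split => -[].
exists (~` B); split => //; first exact: measurableC.
by move=> y' By' x /=; apply/propext; split => -[].
Qed.

(** The sublevel sets at the countably many rational levels determine [h], and a countable
    intersection of the sets [W q] stays measurable. *)
Lemma fun_section_locally_constant {R : realType} (h : X * Y -> R) (y : Y) :
  measurable_fun setT h ->
  exists W : set Y, [/\ measurable W, W y &
    forall y', W y' -> forall x, h (x, y') = h (x, y)].
Proof.
move=> mh.
have /choice[W WP] (q : rat) : exists W : set Y, [/\ measurable W, W y &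
    forall y', W y' -> forall x, (h (x, y') < ratr q) = (h (x, y) < ratr q)].
  have [W [mW Wy WA]] := @section_locally_constant
    (h @^-1` [set` `]-oo, (ratr q : R)[]) y
    (ltac:(rewrite -[X in measurable X]setTI; exact: mh)).
  exists W; split => // y' Wy' x; have := WA _ Wy' x.
  by rewrite /= !in_itv/= => /= e; apply/idP/idP; rewrite e.
exists (\bigcap_q W q); split.
- rewrite -[X in measurable X]setCK setC_bigcap; apply: measurableC.
  by apply: bigcupT_measurable_rat => q; apply: measurableC; have [] := WP q.
- by move=> q _; have [] := WP q.
- move=> y' Wy' x; apply/eqP; rewrite eq_le !leNgt; apply/andP; split.
    apply/negP => /rat_in_itvoo[q]; rewrite in_itv/= => /andP[q1 q2].
    have [_ _ WF] := WP q; have := WF y' (Wy' q I) x.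
    by rewrite q1 => /esym; rewrite ltNge (ltW q2).
  apply/negP => /rat_in_itvoo[q]; rewrite in_itv/= => /andP[q1 q2].
  have [_ _ WF] := WP q; have := WF y' (Wy' q I) x.
  by rewrite q1 ltNge (ltW q2).
Qed.

End sections.

(** * Integrals of functions locally constant around the atoms *)

Section locally_constant.
Local Open Scope ereal_scope.
Context {d : measure_display} {T : measurableType d} {R : realType}.

Lemma measurable_patch_locally_constant {n} (W : 'I_n -> set T)
    (v : 'I_n -> \bar R) (f : T -> \bar R) :
  (forall k, measurable (W k)) -> (forall k x, W k x -> f x = v k) ->
  measurable_fun setT (f \_ (\bigcup_k W k)).
Proof.
move=> mW fW; apply/(measurable_restrictT _ _).1.
  exact: fin_bigcup_measurable.
pose E (i : nat) := if insub i is Some k then W k else set0.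
have -> : \bigcup_k W k = \bigcup_i E i.
  apply/seteqP; split => [x [k _ Wx]|x [i _]].
    by exists (val k) => //; rewrite /E valK.
  by rewrite /E; case: insubP => // k _ _ Wx; exists k.
apply/measurable_fun_bigcup => i; rewrite /E; case: insubP => // [k _ _|_].
  by apply: (eq_measurable_fun (cst (v k))) => // x /set_mem /fW.
exact: measurable_fun_set0.
Qed.

Import HBNNSimple.

(* f is not assumed measurable: the integral is then a supremum over the
   simple functions below f. *)
Lemma integral_atomic_locally_constant {mu : {measure set T -> \bar R}} {n}
    {p : 'I_n -> R} {z : 'I_n -> T} (f : T -> \bar R) :
  atomic mu p z -> (forall x, 0 <= f x) ->
  (forall k, exists W : set T,
    [/\ measurable W, W (z k) & forall x, W x -> f x = f (z k)]) ->
  \int[mu]_x f x = \sum_(k < n) (p k)%:E * f (z k).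
Proof.
move=> muE f0 /choice[W WP].
have mW k : measurable (W k) by have [] := WP k.
have fW k x : W k x -> f x = f (z k) by have [_ _] := WP k; exact.
have zW k : (\bigcup_k W k) (z k) by exists k => //; have [] := WP k.
(* A measurable minorant of [f] that agrees with it at every atom. *)
pose g := f \_ (\bigcup_k W k).
have g0 x : 0 <= g x by rewrite /g patchE; case: ifP.
have mg : measurable_fun setT g by exact: measurable_patch_locally_constant fW.
have gE : \int[mu]_x g x = \sum_(k < n) (p k)%:E * f (z k).
  rewrite (ge0_integral_atomic muE)//; apply: eq_bigr => k _.
  by rewrite /g patchE mem_set.
apply/eqP; rewrite eq_le; apply/andP; split; last first.
  rewrite -gE !ge0_integralTE//; apply: le_ereal_sup => _ [h hg <-].
  exists h => // x; apply: (le_trans (hg x)).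
  by rewrite /g patchE; case: ifP.
rewrite ge0_integralTE//; apply: ge_ereal_sup => _ [h hf <-].
rewrite -integralT_nnsfun (ge0_integral_atomic muE)//.
- by apply: lee_sum => k _; apply: lee_wpmul2l; rewrite ?lee_fin//; have [] := muE.
- exact/measurable_EFinP/measurable_funPT.
- by move=> x; rewrite lee_fin fun_ge0.
Qed.

End locally_constant.

(** * Gibbs' inequalities for finite sums *)

Lemma sum1_gt0 {R : realType} {n} (p : 'I_n -> R) :
  \sum_(k < n) p k = 1 -> (0 < n)%N.
Proof. by case: n p => // p; rewrite big_ord0 => /esym/eqP; rewrite oner_eq0. Qed.

Lemma sum_expR_gt0 {R : realType} {n} (q F : 'I_n -> R) :
  (0 < n)%N -> (forall k, 0 < q k) -> 0 < \sum_(k < n) q k * expR (F k).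
Proof.
case: n q F => // n q F _ q0.
rewrite big_ord_recl ltr_pwDl ?mulr_gt0 ?expR_gt0// sumr_ge0// => i _.
by rewrite mulr_ge0 ?expR_ge0 ?ltW.
Qed.

(** Weight [1 + x <= expR x] at [x = F k - ln (r k) - ln S] by [q k * r k] and sum: the terms
    without logarithms total 1 on both sides. *)
Lemma gibbs_le {R : realType} {n} (q r F : 'I_n -> R) :
  (forall k, 0 < q k) -> (forall k, 0 <= r k) -> \sum_(k < n) q k * r k = 1 ->
  \sum_(k < n) q k * r k * F k <=
    \sum_(k < n) q k * r k * ln (r k) + ln (\sum_(k < n) q k * expR (F k)).
Proof.
move=> q0 r0 qr1; set S := \sum_(k < n) q k * expR (F k).
have S0 : 0 < S by rewrite sum_expR_gt0// (sum1_gt0 _ qr1).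
suff H k : q k * r k * F k - q k * r k * ln (r k) - q k * r k * ln S <=
    q k * expR (F k) / S - q k * r k.
  rewrite -lerBlDl -[X in _ <= X]mul1r -qr1 mulr_suml -subr_le0 -!sumrB.
  apply: (le_trans (ler_sum _ (fun k _ => H k))).
  by rewrite sumrB -mulr_suml qr1 -/S divff ?gt_eqF// subrr.
rewrite -!mulrBr -!mulrA -!mulrBr ler_pM2l//.
have [->|rk] := eqVneq (r k) 0; first by rewrite !mul0r subr0 divr_ge0 ?expR_ge0 ?ltW.
have {}rk : 0 < r k by rewrite lt_neqAle eq_sym rk r0.
have := ler_wpM2l (ltW rk) (expR_ge1Dx (F k - ln (r k) - ln S)).
rewrite 2!expRD !expRN !lnK ?posrE//.
have -> : expR (F k) / S = r k * (expR (F k) / r k / S).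
  by field; rewrite !gt_eqF.
lra.
Qed.

(* Since F k - ln S = ln (p k / q k), this bounds the divergence computed with
   the density r even when p differs from q r. *)
Lemma gibbs_ge {R : realType} {n} (p q r F : 'I_n -> R) (S : R) :
  0 < S -> (forall k, p k = q k * expR (F k) / S) -> (forall k, 0 < p k) ->
  (forall k, 0 < r k) -> \sum_(k < n) p k = 1 -> \sum_(k < n) q k * r k = 1 ->
  \sum_(k < n) p k * ln (r k) <= \sum_(k < n) p k * (F k - ln S).
Proof.
move=> S0 pE p0 r0 p1 qr1.
rewrite -subr_le0 -sumrB -[X in _ <= X](subrr 1) -[X in _ <= X - _]qr1 -[X in _ <= _ - X]p1.
rewrite -sumrB; apply: ler_sum => k _.
(* The exponent is chosen so that [p k] times its exponential is [q k * r k], which sums to 1 as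
   [p k] does. *)
have := ler_wpM2l (ltW (p0 k)) (expR_ge1Dx (ln (r k) - (F k - ln S))).
rewrite opprB expRD expRB !lnK ?posrE//.
have -> : p k * (r k * (S / expR (F k))) = q k * r k.
  by rewrite pE; field; rewrite !gt_eqF ?expR_gt0.
lra.
Qed.

(** * Monotonicity and change of variables for signed integrands *)

Section measure_lemmas.
Local Open Scope ereal_scope.
Context {R : realType}.

Lemma integral_le {d} {T : measurableType d} (mu : {measure set T -> \bar R})
    (f g : T -> \bar R) : measurable_fun setT f -> measurable_fun setT g ->
  (forall x, f x <= g x) -> \int[mu]_x f x <= \int[mu]_x g x.
Proof.
move=> mf mg fg; rewrite integralE [leRHS]integralE.
apply: leeB; apply: ge0_le_integral => //.
- exact: measurable_funepos.
- exact: measurable_funepos.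
- by move=> x _; rewrite !funeposE; apply: le_max2.
- exact: measurable_funeneg.
- exact: measurable_funeneg.
- by move=> x _; rewrite !funenegE; apply: le_max2 => //; rewrite leeN2.
Qed.

Lemma integral_marginal {d1 d2} {X : measurableType d1} {Y : measurableType d2}
    {mu : {measure set X -> \bar R}} {nu : {measure set Y -> \bar R}}
    {phi : X -> Y} (f : Y -> \bar R) :
  measurable_fun setT phi ->
  (forall A, measurable A -> pushforward mu phi A = nu A) ->
  measurable_fun setT f -> \int[nu]_y f y = \int[mu]_x f (phi x).
Proof.
move=> mphi munu mf.
have ge0 (g : Y -> \bar R) : measurable_fun setT g -> (forall y, 0 <= g y) ->
    \int[nu]_y g y = \int[mu]_x g (phi x).
  move=> mg g0; rewrite -(preimage_setT phi) -ge0_integral_pushforward//.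
  by apply: eq_measure_integral => A mA _; rewrite -munu.
rewrite integralE [RHS]integralE (funepos_comp f phi) (funeneg_comp f phi).
congr (_ - _); apply: ge0 => //.
- exact: measurable_funepos.
- exact: measurable_funeneg.
Qed.

End measure_lemmas.

(** * The upper bound: densities, the c-transform and couplings *)

Section upper_bound.
Local Open Scope ereal_scope.
Context {d : measure_display} {Xi : measurableType d} {R : realType}.

Lemma measurable_lne : measurable_fun setT (@lne R).
Proof.
move=> _; apply: (measurability _ (ErealGenOInfty.measurableE R)) => //.
move=> _ [_ [r ->] <-]; rewrite setTI.
rewrite (_ : _ @^-1` _ = `](expeR r%:E), +oo[%classic); first exact: emeasurable_itv.
apply/seteqP; split => x /=; rewrite !in_itv/= !andbT.
  have [/le0_lneNy->//|/ltW] := leP x 0.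
  by rewrite -lneK_eq => /eqP lx rx; rewrite -lx -[_%:E]/(expeR r%:E) lte_expeR.
move=> rx; have : 0 <= x by rewrite (le_trans _ (ltW rx))// lee_fin expR_ge0.
by rewrite -lneK_eq => /eqP lx; rewrite -lte_expeR lx.
Qed.

(* r k is the value at z k of the Radon-Nikodym density of P.  The weights p
   may differ from q r when distinct atoms are inseparable. *)
Lemma KL_atomic {P Q : probability Xi R} {n} {q : 'I_n -> R} {z : 'I_n -> Xi} :
  atomic Q q z -> (forall k, (0 < q k)%R) -> P `<< Q ->
  exists r : 'I_n -> R, [/\ forall k, (0 <= r k)%R,
    atomic P (fun k => (q k * r k)%R) z &
    forall p : 'I_n -> R, atomic P p z ->
      (forall k, (0 < p k)%R -> (0 < r k)%R) /\
      KL P Q = (\sum_(k < n) p k * ln (r k))%:E].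
Proof.
move=> QE q0 PQ.
set g := Radon_Nikodym (charge_of_finite_measure P) Q.
have gfin x : g x \is a fin_num by apply: Radon_Nikodym_fin_num.
have mg : measurable_fun setT g.
  by apply: (measurable_int Q); apply: Radon_Nikodym_integrable.
pose r k := fine (g (z k)).
have rE k : (r k)%:E = g (z k) by rewrite fineK.
have PE A : measurable A ->
    P A = \sum_(k < n) (q k * r k)%:E * \d_(z k) A.
  move=> mA.
  have -> : P A = \int[Q]_(x in A) g x.
    exact: (@Radon_Nikodym_integral _ _ _ (charge_of_finite_measure P) Q).
  rewrite integral_mkcond (integral_atomic QE).
  - rewrite -sumEFin; apply: eq_bigr => k _; rewrite patchE diracE.
    by case: ifP => _; rewrite ?mule1 ?mule0 ?mulr0.
  - by apply/(measurable_restrictT _ _).1 => //; exact: measurable_funTS.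
  - by move=> k _; rewrite patchE; case: ifP.
(* [P A] is nonnegative and also minus a sum of nonnegative terms, hence zero. This yields
   [r k >= 0] at every atom and [r k > 0] wherever [p k > 0]. *)
pose A := g @^-1` [set` `]-oo, 0]].
have mA : measurable A by rewrite -[A]setTI; apply: mg => //; exact: emeasurable_itv.
have AE k : (z k \in A) = (r k <= 0)%R.
  rewrite -lee_fin rE; apply/idP/idP => [/set_mem|gz]; first by rewrite /A/= in_itv.
  by apply/mem_set; rewrite /A/= in_itv.
have PAE : P A = - (\sum_(k < n) (if (r k <= 0)%R then - (q k * r k) else 0)%R)%:E.
  rewrite PE// -EFinN -sumrN -sumEFin; apply: eq_bigr => k _.
  by rewrite diracE AE; case: ifP => _; rewrite ?mule1 ?mule0 ?opprK ?oppr0.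
have tge0 k : (0 <= (if (r k <= 0)%R then - (q k * r k) else 0))%R.
  by case: ifP => // rk; rewrite oppr_ge0 pmulr_rle0.
have sge0 : (0 <= \sum_(k < n) (if (r k <= 0)%R then - (q k * r k) else 0))%R.
  by apply: sumr_ge0.
have PA0 : P A = 0.
  apply/eqP; rewrite eq_le measure_ge0 andbT PAE -EFinN lee_fin oppr_le0.
  exact: sge0.
have r0 k : (0 <= r k)%R.
  rewrite leNgt; apply/negP => rk.
  have : (\sum_(k < n) (if (r k <= 0) then - (q k * r k) else 0) = 0)%R.
    by move: PAE; rewrite PA0 -EFinN => -[/esym/eqP]; rewrite oppr_eq0 => /eqP.
  move=> /psumr_eq0P => /(_ (fun i _ => tge0 i)) /(_ k isT).
  rewrite (ltW rk) => /eqP; rewrite oppr_eq0 mulf_eq0 gt_eqF//=.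
  by rewrite lt_eqF.
exists r; split => //.
  by split => // k; rewrite mulr_ge0 ?r0 ?(ltW (q0 k)).
move=> p pE; have [p0 PpE] := pE.
have r_gt0 k : (0 < p k)%R -> (0 < r k)%R.
  move=> pk; rewrite ltNge; apply/negP => rk.
  have : (p k)%:E <= P A.
    rewrite PpE// (bigD1 k)//= diracE AE rk mule1 leeDl// sume_ge0// => i _.
    by rewrite mule_ge0 ?lee_fin// diracE.
  by rewrite PA0 lee_fin leNgt pk.
split => //.
rewrite /KL; case: asboolP => // _.
rewrite -/g (integral_atomic pE).
- congr EFin; apply: eq_bigr => k _.
  have := p0 k; rewrite le_eqVlt => /predU1P[<-|pk]; first by rewrite !mul0r.
  by rewrite -rE lne_EFin// r_gt0.
- apply: measurableT_comp => //.
  exact: measurable_lne.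
- by move=> k pk; rewrite -rE lne_EFin// r_gt0.
Qed.

Context {L : Xi -> R} {c : Xi -> Xi -> R} {rho beta : R}.
Hypothesis mL : measurable_fun setT L.
Hypothesis mc : measurable_fun setT (fun z : Xi * Xi => c z.1 z.2).
Hypothesis c_ge0 : forall xi zeta, (0 <= c xi zeta)%R.
Hypotheses (rho_gt0 : (0 < rho)%R) (beta_gt0 : (0 < beta)%R).

(** The c-transform of [L] for the cost [rho * c], as in Kantorovich duality; the value [+oo] is
    allowed. *)
Definition ctransform (zeta : Xi) : \bar R :=
  ereal_sup (range (fun xi => (L xi - rho * c xi zeta)%:E)).

Lemma ctransform_gtNy zeta : -oo < ctransform zeta.
Proof.
apply: (@lt_le_trans _ _ (L zeta - rho * c zeta zeta)%:E); first exact: ltNyr.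
by apply: ereal_sup_ubound; exists zeta.
Qed.

(** Over [W] the functions of [xi] under the supremum coincide, hence so do their suprema, however
    large [Xi] is. *)
Lemma ctransform_locally_constant y : exists W : set Xi, [/\ measurable W, W y &
  forall y', W y' -> ctransform y' = ctransform y].
Proof.
have mh : measurable_fun setT (fun w : Xi * Xi => L w.1 - rho * c w.1 w.2)%R.
  apply: measurable_funB; first exact: measurableT_comp.
  by apply: measurable_funM.
have [W [mW Wy WE]] := fun_section_locally_constant _ y mh.
exists W; split => // y' Wy'; rewrite /ctransform.
suff -> : (fun xi => (L xi - rho * c xi y')%:E) =
          (fun xi => (L xi - rho * c xi y)%:E) by [].
by apply/funext => x; rewrite (WE _ Wy' x).
Qed.

(** Weak duality: integrate [L xi <= rho * c xi zeta + ctransform zeta] against the coupling, with a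
    measurable substitute for [ctransform]. *)
Lemma expectation_le_coupling {P Pb : probability Xi R}
    {g : probability (Xi * Xi)%type R}
    {n} {p : 'I_n -> R} {z : 'I_n -> Xi} :
  couplings P Pb g -> atomic Pb p z ->
  (forall k, ctransform (z k) \is a fin_num) ->
  \int[P]_x (L x)%:E <= rho%:E * \int[g]_w (c w.1 w.2)%:E +
    (\sum_(k < n) p k * fine (ctransform (z k)))%:E.
Proof.
move=> [gP gPb] PbE ffin.
have [p0 PbA] := PbE.
have /choice[W WP] k := ctransform_locally_constant (z k).
have mW k : measurable (W k) by have [] := WP k.
have fW k x : W k x -> ctransform x = ctransform (z k).
  by have [_ _] := WP k; exact.
set V := \bigcup_k W k.
have mV : measurable V by apply: fin_bigcup_measurable.
have zV k : V (z k) by exists k => //; have [] := WP k.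
(* [u] is measurable, finite everywhere, and equal to [ctransform] on [V], a set of full
   [Pb]-measure. *)
pose u := ctransform \_ V.
have mu : measurable_fun setT u by exact: measurable_patch_locally_constant fW.
have ufin x : u x \is a fin_num.
  by rewrite /u patchE; case: ifPn => // /set_mem[k _ /fW ->].
have uz k : u (z k) = ctransform (z k) by rewrite /u patchE mem_set.
have mu2 : measurable_fun setT (fun w : Xi * Xi => u w.2) by exact: measurableT_comp.
have mcE : measurable_fun setT (fun w : Xi * Xi => (c w.1 w.2)%:E).
  exact/measurable_EFinP.
have iu : g.-integrable setT (fun w => u w.2).
  apply/integrableP; split => //.
  rewrite -(integral_marginal (phi := snd) (fun x => `|u x|) measurable_snd gPb); last exact: measurableT_comp.
  rewrite (integral_atomic PbE) ?ltry//; first exact: measurableT_comp.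
  by move=> k _; rewrite abse_fin_num.
have uE : \int[g]_w u w.2 = (\sum_(k < n) p k * fine (ctransform (z k)))%:E.
  rewrite -(integral_marginal u measurable_snd gPb mu) (integral_atomic PbE)//.
  by congr EFin; apply: eq_bigr => k _; rewrite uz.
rewrite -uE.
have c0 : 0 <= \int[g]_w (c w.1 w.2)%:E by apply: integral_ge0 => w _; rewrite lee_fin.
have [cy|cfin] := eqVneq (\int[g]_w (c w.1 w.2)%:E) +oo.
  by rewrite cy gt0_muley ?lte_fin// uE addye// leey.
have ic : g.-integrable setT (fun w => (c w.1 w.2)%:E).
  apply/integrableP; split => //.
  under eq_integral do rewrite gee0_abs ?lee_fin//.
  by rewrite ltey.
rewrite -integralZl// -integralD//; last exact: integrableZl.
have mLE : measurable_fun setT (fun w : Xi * Xi => (L w.1)%:E).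
  by apply/measurable_EFinP; exact: measurableT_comp.
rewrite (integral_marginal (phi := fst) _ measurable_fst gP); last exact/measurable_EFinP.
have mVV : measurable (snd @^-1` V : set (Xi * Xi)).
  by rewrite -[X in measurable X]setTI; exact: measurable_snd.
(* The coupling does not charge second coordinates outside [V]; once the loss is cut to zero there,
   the pointwise inequality reads [0 <= rho * c]. *)
rewrite (@ae_eq_integral _ _ _ g setT
  ((fun w : Xi * Xi => (L w.1)%:E) \_ (snd @^-1` V))
  (fun w : Xi * Xi => (L w.1)%:E))//; last 2 first.
- apply/(measurable_restrictT _ _).1 => //; exact: measurable_funTS.
- exists (snd @^-1` (~` V)); split.
  + by rewrite preimage_setC; exact: measurableC.
  + rewrite -[LHS]/(pushforward g snd (~` V)) gPb; last exact: measurableC.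
    rewrite PbA; last exact: measurableC.
    rewrite big1// => k _; rewrite diracE memNset ?mule0//; exact.
  + move=> w /=; apply: contra_notP => /contrapT Vw _.
    by rewrite patchE mem_set.
apply: integral_le.
- apply/(measurable_restrictT _ _).1 => //; exact: measurable_funTS.
- by apply: emeasurable_funD => //; exact: measurable_funeM.
- move=> w; rewrite patchE; case: ifPn => Vw.
    rewrite /u patchE ifT; last exact/mem_set/set_mem.
    rewrite -leeBlDl// -EFinM -EFinB.
    by apply: ereal_sup_ubound; exists w.1.
  rewrite /u patchE ifF; first by rewrite adde0 -EFinM lee_fin mulr_ge0// ltW.
  by apply/negbTE; apply: contra Vw => /set_mem Vw; apply/mem_set.
Qed.

Lemma robust_value_le {P Q : probability Xi R} {n} {q : 'I_n -> R} {z : 'I_n -> Xi} :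
  atomic Q q z -> (forall k, (0 < q k)%R) ->
  (forall k, ctransform (z k) \is a fin_num) ->
  \int[P]_x (L x)%:E - rho%:E * UW c beta P Q <=
  (rho * beta * ln (\sum_(k < n)
    q k * expR (fine (ctransform (z k)) / (rho * beta))))%:E.
Proof.
move=> QE q0 ffin; set S := (\sum_(k < n) _)%R.
have rb0 : (0 < rho * beta)%R by rewrite mulr_gt0.
(* [UW] being an infimum, a bound for each admissible pair suffices. *)
have key (Pb : probability Xi R) (g : probability (Xi * Xi)%type R) :
    couplings P Pb g ->
    \int[P]_x (L x)%:E <= rho%:E *
      (\int[g]_w (c w.1 w.2)%:E + beta%:E * KL Pb Q) +
      (rho * beta * ln S)%:E.
  move=> Pg.
  have c0 : 0 <= \int[g]_w (c w.1 w.2)%:E by apply: integral_ge0 => w _; rewrite lee_fin.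
  have [PbQ|PbQ] := pselect (Pb `<< Q); last first.
    rewrite /KL asboolF// gt0_muley ?lte_fin// addey ?gt_eqF ?(lt_le_trans _ c0)//.
    by rewrite gt0_muley ?lte_fin// addye// leey.
  have [r [r0 PbE /(_ _ PbE)[_ ->]]] := KL_atomic QE q0 PbQ.
  apply: (le_trans (expectation_le_coupling Pg PbE ffin)).
  rewrite -EFinM (@muleDr _ _ (\int[g]_w (c w.1 w.2)%:E))//; last exact: fin_num_adde_defl.
  rewrite -addeA leeD2l// -EFinM -EFinD lee_fin.
  have := gibbs_le q r (fun k => fine (ctransform (z k)) / (rho * beta))%R q0 r0 (atomic_sum1 PbE).
  rewrite -/S -(ler_pM2l rb0) mulrDr mulrA => /(le_trans _); apply.
  rewrite mulr_sumr le_eqVlt; apply/orP; left; apply/eqP; apply: eq_bigr => k _.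
  by field; rewrite !gt_eqF.
rewrite lee_subel_addr// -leeBlDl// -lee_pdivrMl//.
apply: le_ereal_inf_tmp => _ [[Pb g] /= Pg <-].
by rewrite lee_pdivrMl// EFinN leeBlDl// addeC key.
Qed.

End upper_bound.

(** * The lower bound: transporting Gibbs weights *)

Section lower_bound.
Local Open Scope ereal_scope.
Context {d : measure_display} {Xi : measurableType d} {R : realType}.

Lemma simplex_ge0 {n} (w : simplex R n) k : (0 <= val w ord0 k)%R.
Proof. by have [] := set_valP w. Qed.

Lemma mixture_dirac_atomic {d'} {T : measurableType d'} {n} (w : simplex R n)
    (z : 'I_n -> T) :
  atomic (mixture (fun k => dirac (z k) : probability T R) w)
         (fun k => val w ord0 k) z.
Proof. by split => // k; exact: simplex_ge0. Qed.

Context {L : Xi -> R} {c : Xi -> Xi -> R} {rho beta : R}.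
Hypothesis mL : measurable_fun setT L.
Hypothesis mc : measurable_fun setT (fun z : Xi * Xi => c z.1 z.2).
Hypotheses (rho_gt0 : (0 < rho)%R) (beta_gt0 : (0 < beta)%R).

Lemma robust_value_ge {Q : probability Xi R} {n} {q : 'I_n -> R} {z : 'I_n -> Xi}
    (x : 'I_n -> Xi) : atomic Q q z -> (forall k, (0 < q k)%R) ->
  exists P : probability Xi R, expectation_defined P L /\
  (rho * beta * ln (\sum_(k < n)
     q k * expR ((L (x k) - rho * c (x k) (z k)) / (rho * beta))))%:E <=
  \int[P]_x (L x)%:E - rho%:E * UW c beta P Q.
Proof.
move=> QE q0.
pose F k := ((L (x k) - rho * c (x k) (z k)) / (rho * beta))%R.
set S := (\sum_(k < n) _)%R.
have rb0 : (0 < rho * beta)%R by rewrite mulr_gt0.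
have S0 : (0 < S)%R by rewrite sum_expR_gt0// (sum1_gt0 _ (atomic_sum1 QE)).
(* Here [ln (p k / q k) = F k - ln S], the case of equality in Gibbs' inequality. *)
pose p k := (q k * expR (F k) / S)%R.
have p0 k : (0 < p k)%R by rewrite divr_gt0 ?mulr_gt0 ?expR_gt0.
have p1 : (\sum_(k < n) p k = 1)%R by rewrite -mulr_suml divff// gt_eqF.
have wP : simplex R n (\row_k p k).
  split=> [k|]; first by rewrite mxE ltW.
  by under eq_bigr do rewrite mxE.
pose w : simplex R n := SigSub (mem_set wP).
have atomE d' (T : measurableType d') (a : 'I_n -> T) :
    atomic (mixture (fun k => dirac (a k) : probability T R) w) p a.
  have [_ aE] := mixture_dirac_atomic w a; split=> [k|A mA]; first exact: ltW.
  by rewrite aE//; apply: eq_bigr => k _; rewrite /= mxE.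
pose P : probability Xi R := mixture (fun k => dirac (x k) : probability Xi R) w.
pose Pb : probability Xi R := mixture (fun k => dirac (z k) : probability Xi R) w.
(* The plan with mass [p k] at the pair of [x k] and [z k]; its marginals are [P] and [Pb]. *)
pose g : probability (Xi * Xi)%type R :=
  mixture (fun k => dirac (x k, z k) : probability (Xi * Xi)%type R) w.
have PE : atomic P p x := atomE _ _ x.
have PbE : atomic Pb p z := atomE _ _ z.
have gE : atomic g p (fun k => (x k, z k)) := atomE _ _ (fun k => (x k, z k)).
exists P; split.
  apply: fin_num_adde_defl; rewrite fin_numN (integral_atomic PE)//.
    by apply: measurable_funeneg; exact/measurable_EFinP.
  by move=> k _; rewrite funenegE /maxe; case: ifP.
have PbQ : Pb `<< Q.
  apply/null_content_dominatesP => A mA QA0.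
  have : Q A = 0 by exact: QA0.
  rewrite QE.2// => /eqP.
  rewrite seq_psume_eq0; last by move=> k _; rewrite mule_ge0 ?lee_fin ?(ltW (q0 k))// diracE.
  move=> /allP QA; rewrite PbE.2// big1// => k _.
  have := QA k; rewrite mem_index_enum => /(_ isT).
  by rewrite mule_eq0 eqe gt_eqF//= => /eqP ->; rewrite mule0.
(* The divergence is expanded in the weights [p] themselves, which [gibbs_ge] allows to differ from
   [q k * r k]. *)
have [r [r0 PbE' /(_ _ PbE)[r_gt0 KLE]]] := KL_atomic QE q0 PbQ.
have gib := gibbs_ge p q r F S S0 (fun=> erefl) p0 (fun k => r_gt0 k (p0 k)) p1 (atomic_sum1 PbE').
have UWle : UW c beta P Q <=
    (\sum_(k < n) p k * c (x k) (z k) + beta * \sum_(k < n) p k * ln (r k))%:E.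
  apply: ereal_inf_lbound; exists (Pb, g) => /=.
    split => A mA.
      by apply: eq_bigr => k _; congr (_ * _).
    by apply: eq_bigr => k _; congr (_ * _).
  rewrite KLE (integral_atomic gE)//; exact/measurable_EFinP.
apply: le_trans (leeB (lexx _) (lee_wpmul2l _ UWle)); last by rewrite lee_fin ltW.
rewrite (integral_atomic PE)//; last exact/measurable_EFinP.
rewrite -EFinM -EFinB lee_fin/=.
have LE : (\sum_(k < n) p k * L (x k) =
    rho * beta * \sum_(k < n) p k * F k + rho * \sum_(k < n) p k * c (x k) (z k))%R.
  rewrite !mulr_sumr -big_split/=; apply: eq_bigr => k _.
  by rewrite /F; field; rewrite !gt_eqF.
have FE : (\sum_(k < n) p k * (F k - ln S) = \sum_(k < n) p k * F k - ln S)%R.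
  by under eq_bigr do rewrite mulrBr; rewrite sumrB -mulr_suml p1 mul1r.
move: gib; rewrite FE -(ler_pM2l rb0) LE; lra.
Qed.

End lower_bound.

(** * Suprema, exponentials and the identity between the objectives *)

Section equivalence.
Local Open Scope ereal_scope.
Context {R : realType}.

(** Suprema are taken one index at a time, [b] collecting the summands at points already chosen;
    [t k] enters only through the upper bounds of [a k]. *)
Lemma le_sum_sup {T : Type} (x0 : T) {n} (a : 'I_n -> T -> \bar R)
    (t : 'I_n -> \bar R) (b M : \bar R) :
  0 <= b -> (forall k x, 0 <= a k x) -> (forall k, 0 <= t k) ->
  (forall k y, (forall x, a k x <= y) -> t k <= y) ->
  (forall x : 'I_n -> T, b + \sum_(k < n) a k (x k) <= M) ->
  b + \sum_(k < n) t k <= M.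
Proof.
elim: n a t b => [|n IH] a t b b0 a0 t0 at_ bM.
  by have := bM (fun=> x0); rewrite !big_ord0.
rewrite big_ord_recl addeCA.
set C := b + _.
have C0 : 0 <= C by rewrite adde_ge0// sume_ge0.
have aC x : a ord0 x + C <= M.
  rewrite /C addeCA addeA.
  apply: (IH (fun k => a (lift ord0 k))) => [|k y|k|k y|y].
  - by rewrite adde_ge0.
  - exact: a0.
  - exact: t0.
  - exact: at_.
  - have := bM (fun k => if unlift ord0 k is Some j then y j else x).
    rewrite big_ord_recl unlift_none addeA.
    by under eq_bigr do rewrite liftK.
(* The upper bound passed to [at_] is [M - C], for [C] finite; if [C = +oo], the point [x0] forces
   [M = +oo]. *)
have [Coo|Coo] := eqVneq C +oo.
  have := aC x0; rewrite Coo addey ?gt_eqF ?(lt_le_trans _ (a0 _ _))//.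
  by rewrite leye_eq => /eqP ->; rewrite leey.
have Cfin : C \is a fin_num by rewrite ge0_fin_numE// ltey.
by rewrite -leeBrDr//; apply: at_ => x; rewrite leeBrDr.
Qed.

(** An adjunction, as [y >= 0] is the exponential of [lne y]; it carries suprema through the
    exponential, infinite values included. *)
Lemma expeR_scale_le (r : R) (x y : \bar R) : (0 < r)%R -> 0 <= y ->
  (expeR (r^-1%:E * x) <= y) = (x <= r%:E * lne y).
Proof.
move=> r0; rewrite -lneK_eq => /eqP lny.
by rewrite -[in LHS]lny lee_expeR lee_pdivrMl.
Qed.

(** The point [t0] matters: over an empty type the left side is [-oo] and the right side 0. *)
Lemma ereal_sup_expeR_scale {T : Type} (r : R) (t0 : T) (J : T -> \bar R) :
  (0 < r)%R ->
  ereal_sup (range (fun t => expeR (r^-1%:E * J t))) =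
  expeR (r^-1%:E * ereal_sup (range J)).
Proof.
move=> r0; apply/eqP; rewrite eq_le; apply/andP; split.
  apply: ge_ereal_sup => _ [t _ <-].
  rewrite lee_expeR lee_pmul2l ?lte_fin ?invr_gt0//.
  by apply: ereal_sup_ubound; exists t.
have ub t : expeR (r^-1%:E * J t) <=
    ereal_sup (range (fun t => expeR (r^-1%:E * J t))).
  by apply: ereal_sup_ubound; exists t.
have s0 := le_trans (expeR_ge0 _) (ub t0).
rewrite expeR_scale_le//; apply: ge_ereal_sup => _ [t _ <-].
by rewrite -expeR_scale_le.
Qed.

Context {d : measure_display} {Xi : measurableType d}.

(** Atoms are indexed by pairs of a component and one of its atoms; only pairs of positive weight
    are kept, as both bounds require. *)
Lemma mixture_finitely_supported {N} {Phat : 'I_N -> probability Xi R}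
    (lam : simplex R N) : (forall i, finitely_supported (Phat i)) ->
  exists (n : nat) (q : 'I_n -> R) (z : 'I_n -> Xi),
  [/\ forall k, (0 < q k)%R, atomic (mixture Phat lam) q z &
   forall f : Xi -> \bar R, (forall x, 0 <= f x) ->
    (forall y, exists W : set Xi,
      [/\ measurable W, W y & forall x, W x -> f x = f y]) ->
    \sum_(i < N) (val lam ord0 i)%:E * \int[Phat i]_x f x =
    \sum_(k < n) (q k)%:E * f (z k)].
Proof.
move=> Pfin.
have /choice[u uP] i : exists u : {n & (simplex R n * ('I_n -> Xi))%type},
    atomic (Phat i) (fun j => val (tagged u).1 ord0 j) (tagged u).2.
  have [n [w [z PE]]] := Pfin i; exists (existT _ n (w, z)).
  by split => [j|]; [exact: simplex_ge0|exact: PE].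
pose I := {i : 'I_N & 'I_(tag (u i))}.
pose wt (v : I) : R :=
  (val lam ord0 (tag v) * val (tagged (u (tag v))).1 ord0 (tagged v))%R.
pose pt (v : I) : Xi := (tagged (u (tag v))).2 (tagged v).
have wt0 v : (0 <= wt v)%R by rewrite mulr_ge0 ?simplex_ge0.
pose s := in_tuple (enum [pred v : I | 0 < wt v]%R).
exists (size s), (fun k => wt (tnth s k)), (fun k => pt (tnth s k)).
have sE (G : Xi -> \bar R) : (forall x, 0 <= G x) ->
    \sum_(k < size s) (wt (tnth s k))%:E * G (pt (tnth s k)) =
    \sum_(i < N) (val lam ord0 i)%:E *
      \sum_j (val (tagged (u i)).1 ord0 j)%:E * G ((tagged (u i)).2 j).
  move=> G0.
  rewrite -(big_tnth _ _ s xpredT (fun v => (wt v)%:E * G (pt v))) big_enum/=.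
  rewrite big_mkcond/=.
  rewrite [RHS](eq_bigr (fun i => \sum_j (val lam ord0 i)%:E *
      ((val (tagged (u i)).1 ord0 j)%:E * G ((tagged (u i)).2 j)))); last first.
    move=> i _; rewrite ge0_sume_distrr// => j _.
    by rewrite mule_ge0 ?lee_fin ?simplex_ge0.
  rewrite sig_big_dep/=; apply: eq_bigr => v _.
  rewrite muleA -EFinM -/(wt v) -/(pt v) inE.
  have := wt0 v; rewrite le_eqVlt => /predU1P[<-|->//].
  by rewrite ltxx mul0e.
split=> [k||f f0 fW].
- by have := mem_tnth k s; rewrite mem_enum.
- split=> // A mA; rewrite (sE (fun x => \d_x A))//.
  by apply: eq_bigr => i _; rewrite (uP i).2.
- rewrite sE//; apply: eq_bigr => i _; congr (_ * _).
  exact: integral_atomic_locally_constant (uP i) f0 (fun=> fW _).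
Qed.

Lemma exponential_objectiveE {Theta : Type} {N} (Phat : 'I_N -> probability Xi R)
    (rho beta : R) (L : Theta -> Xi -> R) (c : Xi -> Xi -> R)
    (theta : Theta) (lam : simplex R N) :
  (forall i, finitely_supported (Phat i)) -> (0 < rho)%R -> (0 < beta)%R ->
  measurable_fun setT (L theta) ->
  measurable_fun setT (fun z : Xi * Xi => c z.1 z.2) ->
  (forall xi zeta, (0 <= c xi zeta)%R) ->
  exponential_objective Phat rho beta L c theta lam =
  expeR ((rho * beta)^-1%:E * robust_objective Phat rho beta L c theta lam).
Proof.
move=> Pfin rho0 beta0 mL mc c0.
have rb0 : (0 < rho * beta)%R by rewrite mulr_gt0.
have [n [q [z [q0 QE intE]]]] := mixture_finitely_supported lam Pfin.
pose f := @ctransform _ _ _ (L theta) c rho.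
have -> : exponential_objective Phat rho beta L c theta lam =
    \sum_(k < n) (q k)%:E * expeR ((rho * beta)^-1%:E * f (z k)).
  rewrite -(intE (fun y => expeR ((rho * beta)^-1%:E * f y))).
  - by apply: eq_bigr => i _; congr (_ * _); apply: eq_integral => y _; rewrite [RHS]/= muleC.
  - by move=> y; exact: expeR_ge0.
  - move=> y; have [W [mW Wy fW]] := ctransform_locally_constant (rho := rho) mL mc y.
    by exists W; split => // x Wx; rewrite /f fW.
apply/eqP; rewrite eq_le; apply/andP; split.
  rewrite -[leLHS]add0e.
  (* One point is chosen freely per atom; each choice yields a distribution by [robust_value_ge],
     and [le_sum_sup] then takes the suprema. *)
  pose a k x := (q k)%:E *
    (expR ((L theta x - rho * c x (z k)) / (rho * beta)))%:E.
  have x0 : Xi := point.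
  apply: (le_sum_sup x0 a) => //.
  - by move=> k x; rewrite mule_ge0 ?lee_fin ?expR_ge0 ?ltW.
  - by move=> k; rewrite mule_ge0 ?lee_fin ?expeR_ge0 ?ltW.
  - move=> k y ay.
    have y0 : 0 <= (q k)^-1%:E * y.
      rewrite lee_pdivlMl// mule0; apply: le_trans (ay x0).
      by rewrite mule_ge0 ?lee_fin ?expR_ge0 ?ltW.
    rewrite -lee_pdivlMl// expeR_scale_le//.
    apply: ge_ereal_sup => _ [x _ <-].
    rewrite -expeR_scale_le// lee_pdivlMl//.
    by have := ay x; rewrite /a mulrC.
  - move=> x; rewrite add0e.
    have [P [PL vP]] := robust_value_ge mL mc rho0 beta0 x QE q0.
    under eq_bigr do rewrite /a -EFinM.
    rewrite sumEFin.
    set S := (\sum_(k < n) _)%R in vP *.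
    have S0 : (0 < S)%R by rewrite sum_expR_gt0// (sum1_gt0 _ (atomic_sum1 QE)).
    have -> : S%:E = expeR (ln S)%:E by rewrite /= lnK.
    rewrite lee_expeR lee_pdivlMl// -EFinM.
    apply: (le_trans vP); apply: ereal_sup_ubound.
    by exists P.
(* [robust_value_le] covers finite [f (z k)]; a single infinite one, having positive weight, makes
   the exponential objective [+oo]. *)
have [fin|] := pselect (forall k, f (z k) \is a fin_num).
  pose S := (\sum_(k < n) q k * expR (fine (f (z k)) / (rho * beta)))%R.
  have -> : \sum_(k < n) (q k)%:E * expeR ((rho * beta)^-1%:E * f (z k)) = S%:E.
    rewrite -sumEFin; apply: eq_bigr => k _.
    by rewrite EFinM -{1}(fineK (fin k)) -EFinM /= [(_^-1 * _)%R]mulrC.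
  have S0 : (0 < S)%R by rewrite sum_expR_gt0// (sum1_gt0 _ (atomic_sum1 QE)).
  rewrite expeR_scale_le ?lee_fin ?(ltW S0)//.
  apply: ge_ereal_sup => _ [P _ <-].
  apply: (le_trans (robust_value_le mL mc c0 rho0 beta0 QE q0 fin)).
  by rewrite -/S EFinM lee_pmul2l ?lte_fin// lne_EFin.
move=> /existsNP[k fk].
have fky : f (z k) = +oo.
  have := ctransform_gtNy (z k) (L := L theta) (c := c) (rho := rho).
  rewrite -/(f (z k)).
  by move: fk; case: (f (z k)).
rewrite [leRHS](_ : _ = +oo) ?leey//.
rewrite (bigD1 k)//= fky gt0_muley ?lte_fin ?invr_gt0//=.
rewrite gt0_muley ?lte_fin// addye// gt_eqF//.
apply: (@lt_le_trans _ _ 0); rewrite ?ltNyr// sume_ge0// => i _.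
by rewrite mule_ge0 ?expeR_ge0 ?lee_fin ?ltW.
Qed.

End equivalence.

(** * Transfer of maximizers and minimizers *)

Theorem proposition1 (d : measure_display) (Xi : measurableType d)
    (R : realType) (Theta : Type) (N : nat)
    (Phat : 'I_N -> probability Xi R) (rho beta : R)
    (L : Theta -> Xi -> R) (c : Xi -> Xi -> R)
    (Phat_fin : forall i, finitely_supported (Phat i))
    (rho_gt0 : 0 < rho) (beta_gt0 : 0 < beta)
    (mL : forall theta, measurable_fun [set: Xi] (L theta))
    (mc : measurable_fun [set: Xi * Xi] (fun z : Xi * Xi => c z.1 z.2))
    (c_ge0 : forall xi zeta, 0 <= c xi zeta) :
  (forall theta : Theta,
     argmax (robust_objective Phat rho beta L c theta) =
     argmax (exponential_objective Phat rho beta L c theta)) /\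
  argmin (fun theta => ereal_sup
            (range (robust_objective Phat rho beta L c theta))) =
  argmin (fun theta => ereal_sup
            (range (exponential_objective Phat rho beta L c theta))).
Proof.
have rb0 : 0 < rho * beta by rewrite mulr_gt0.
have expE theta lam := exponential_objectiveE Phat rho beta L c theta lam
  Phat_fin rho_gt0 beta_gt0 (mL theta) mc c_ge0.
have scaleE (x y : \bar R) : (expeR ((rho * beta)^-1%:E * x) <=
    expeR ((rho * beta)^-1%:E * y) = (x <= y))%E.
  by rewrite lee_expeR lee_pmul2l// lte_fin invr_gt0.
split=> [theta|].
  apply/seteqP; split => lam H y; have := H y; rewrite !expE scaleE; exact.
have [[lam0 _]|lam0] := pselect (exists lam : simplex R N, True).
  have supE theta : ereal_sup (range (exponential_objective Phat rho beta L c theta)) =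
      expeR ((rho * beta)^-1%:E *
             ereal_sup (range (robust_objective Phat rho beta L c theta))).
    by rewrite (funext (expE theta)) (ereal_sup_expeR_scale _ lam0).
  apply/seteqP; split => theta H y; have := H y; rewrite /= !supE scaleE; exact.
(* The simplex is empty when [N = 0]: both outer objectives are then constantly [-oo], so every
   [theta] minimizes both. *)
have noneE (J : simplex R N -> \bar R) : range J = set0.
  by rewrite -subset0 => x [lam]; case: lam0; exists lam.
by apply/seteqP; split => theta _ y /=; rewrite !noneE.
Qed.
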